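(* Let $\lambda\in(0,1)$ and let $G$ be a finite simple connected graph with $n\ge 2$ vertices. Then $$\min_{1\le D\le n-1}\left[\frac{\lambda\left[D\lambda^{D}-\lambda-(D-1)\lambda^{D+1}\right]}{(\lambda-1)^2}+(n-D-1)\left(\lambda^{D}-D\lambda^{D}\right)\right]\;\le\; m\nu^{e}_{\lambda}(G)\;\le\;0.$$ The lower bound is attained for a broom on $n$ vertices (at its starting vertex), and the upper bound is attained for every vertex-transitive graph.
   Context: $d(u,v)$ denotes graph distance and $[u]$ the set of neighbours of $u$. $t^{e}_{\lambda}(u)=\sum_{v\in V\setminus\{u\}} d(u,v)\lambda^{d(u,v)}$. For vertices $k,l$, $s^{kl}$ is the number of shortest $k$–$l$ paths and, for an edge $uv$, $s^{kl}_{uv}$ is the number of those passing through the edge $uv$. The exponential edge betweenness of an edge $uv$ is $b^{e}_{\lambda}(uv)=\sum_{\{k,l\}}\frac{s^{kl}_{uv}}{s^{kl}}\lambda^{d(k,l)}$ over all unordered pairs $\{k,l\}$ of distinct vertices; $c^{e}_{\lambda}(u)=\sum_{v\in[u]}b^{e}_{\lambda}(uv)$. The network surplus of $u$ is $\nu^{e}_{\lambda}(u)=c^{e}_{\lambda}(u)-t^{e}_{\lambda}(u)$ and $m\nu^{e}_{\lambda}(G)=\min\{\nu^{e}_{\lambda}(u):u\in V(G)\}$. A broom on $n$ vertices (with parameter $D$, $1\le D\le n-1$) is the graph consisting of a path $u=v_0v_1\cdots v_D$ together with $n-D-1$ further vertices each adjacent only to $v_{D-1}$; $u=v_0$ is its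 starting vertex. *)

(* Defs.v *)
From HB Require Import structures.
From mathcomp Require Import all_boot all_order all_algebra.
From mathcomp Require Import perm.
Set Implicit Arguments. Unset Strict Implicit. Unset Printing Implicit Defensive.
Import Order.TTheory GRing.Theory Num.Theory.
Local Open Scope ring_scope.

(* A finite simple graph: vertex set a finType T, adjacency e : rel T,
   assumed symmetric and irreflexive where needed. *)
Section Graph.
Variables (T : finType) (e : rel T).

Definition reach_in (k : nat) (u v : T) : bool :=
  [exists p : k.-tuple T, path e u p && (last u p == v)].

(* graph distance: least k with a walk of length k (walks of minimal length are
   paths); for connected graphs such k exists and is < #|T| *)
Definition dist (u v : T) : nat :=
  find (fun k => reach_in k u v) (iota 0 #|T|).

Definition spaths (k l : T) : {set (dist k l).-tuple T} :=
  [set p : (dist k l).-tuple T | path e k p && (last k p == l)].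

Definition nsp (k l : T) : nat := #|spaths k l|.

Definition uses_edge (k : T) (p : seq T) (u v : T) : bool :=
  ((u, v) \in zip (k :: p) p) || ((v, u) \in zip (k :: p) p).

Definition nsp_edge (k l u v : T) : nat :=
  #|[set p in spaths k l | uses_edge k p u v]|.

Variable R : realFieldType.
Variable lam : R.

Definition texp (u : T) : R :=
  \sum_(v : T | v != u) (dist u v)%:R * lam ^+ dist u v.

(* exponential edge betweenness; unordered pairs {k,l}, k <> l, are enumerated
   once each via enum_rank k < enum_rank l *)
Definition bexp (u v : T) : R :=
  \sum_(k : T) \sum_(l : T | (enum_rank k < enum_rank l)%N)
     ((nsp_edge k l u v)%:R / (nsp k l)%:R) * lam ^+ dist k l.

Definition cexp (u : T) : R := \sum_(v : T | e u v) bexp u v.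

Definition nuexp (u : T) : R := cexp u - texp u.

Definition mnuexp : R :=
  if [pick v : T] is Some v0 then \big[Num.min/nuexp v0]_(v : T) nuexp v
  else 0.

End Graph.

Definition connected_graph (T : finType) (e : rel T) : Prop :=
  forall u v : T, connect e u v.

Definition vertex_transitive (T : finType) (e : rel T) : Prop :=
  forall u v : T, exists f : {perm T},
    f u = v /\ (forall x y : T, e (f x) (f y) = e x y).

(* the broom on n vertices with parameter D: path 0 - 1 - ... - D, and the
   vertices D+1, ..., n-1 each adjacent only to D-1; starting vertex is 0 *)
Definition broom (n D : nat) : rel 'I_n :=
  fun i j =>
    [|| [&& (i <= D)%N, (j <= D)%N & ((i.+1 == j) || (j.+1 == i))],
        (D < i)%N && (val j == D.-1) |
        (D < j)%N && (val i == D.-1)].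

Arguments broom : clear implicits.

Definition lbterm (R : realFieldType) (n : nat) (lam : R) (D : nat) : R :=
  lam * (D%:R * lam ^+ D - lam - (D%:R - 1) * lam ^+ D.+1) / (lam - 1) ^+ 2
  + (n - D - 1)%:R * (lam ^+ D - D%:R * lam ^+ D).

Definition lbound (R : realFieldType) (n : nat) (lam : R) : R :=
  \big[Num.min/lbterm n lam 1]_(1 <= D < n) lbterm n lam D.

(* Main.v *)
(* Summing edge betweenness over the edges at [u] counts, for every pair [{k,l}],
   the average number of steps incident to [u] on a shortest [k]-[l] path: at
   least 1 if [u] is an end of the path, 2 if [u] is interior. Keeping only the
   pairs containing [u] gives [nu(u) >= \sum_(v != u) (1 - d(u,v)) lam^d(u,v)],
   with equality at a vertex of degree one. If [v] minimizes the summand and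
   [D = d(u,v)], the sum contains a term for each distance [1, ..., D] and the
   remaining terms are at least the [D]-th one, whence [lbterm n lam D], the
   surplus at the start of the broom. Each shortest path has [d(k,l)] steps, each
   with two ends, so the surpluses of all the vertices add up to 0; this gives the
   upper bound, and equality when all surpluses coincide. *)
Require Import Defs.
From HB Require Import structures.
From mathcomp Require Import all_boot all_order all_algebra.
From mathcomp Require Import perm.
From mathcomp Require Import zify ring lra.
Import Order.TTheory GRing.Theory Num.Theory.
Local Open Scope ring_scope.
Set Implicit Arguments. Unset Strict Implicit. Unset Printing Implicit Defensive.

(** * Graph distance, shortest walks and their reversal *)

Section Distance.
Local Open Scope nat_scope.
Variables (T : finType) (e : rel T).
Implicit Types (k l u v w : T) (p : seq T) (n : nat).

Lemma reach_inP n u v :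
  reflect (exists p, [/\ path e u p, last u p = v & size p = n])
          (reach_in e n u v).
Proof.
apply: (iffP existsP) => [[p /andP[pp /eqP lp]]|[p [pp lp /eqP sp]]].
  by exists p; split=> //; exact: size_tuple.
by exists (Tuple sp); rewrite pp /= lp eqxx.
Qed.

Lemma dist_le n u v : reach_in e n u v -> dist e u v <= n.
Proof.
move=> h; rewrite /dist; set a := (fun _ => _).
(* For [n] at least [#|T|] the bound is automatic: [find] never exceeds the length of the list
   searched. *)
have [kT|Tk] := ltnP n #|T|; last first.
  by apply: leq_trans Tk; rewrite -[leqRHS](size_iota 0) find_size.
rewrite leqNgt; apply/negP => /(before_find 0).
by rewrite nth_iota // add0n /a h.
Qed.

Hypothesis conn : connected_graph e.

(** A walk shortened to a duplicate-free one has fewer than [#|T|] steps, so the search defining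
    [dist] succeeds and never returns its default [#|T|]. *)
Lemma dist_lt_card u v : dist e u v < #|T|.
Proof.
rewrite /dist -[ltnRHS](size_iota 0) -has_find.
have /connectP[p pp ->] := conn u v.
case: (shortenP pp) => q pq uq _.
apply/hasP; exists (size q); last by apply/reach_inP; exists q.
by rewrite mem_iota add0n -[_.+1]/(size (u :: q)) -(card_uniqP uq) max_card.
Qed.

Lemma reach_dist u v : reach_in e (dist e u v) u v.
Proof.
have := dist_lt_card u v; rewrite {1}/dist -[ltnRHS](size_iota 0) -has_find.
move=> /[dup] /(nth_find 0); rewrite has_find => + h.
by rewrite nth_iota // -[ltnRHS](size_iota 0).
Qed.

Lemma dist_eq0 u v : (dist e u v == 0) = (u == v).
Proof.
apply/idP/idP => [/eqP d0|/eqP ->].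
  have /reach_inP[p [_ + sp]] := reach_dist u v.
  by move: sp; rewrite d0 => /size0nil -> /= ->.
by rewrite -leqn0 dist_le //; apply/reach_inP; exists [::].
Qed.

Lemma dist_step u v w : e v w -> dist e u w <= (dist e u v).+1.
Proof.
move=> vw; have /reach_inP[p [pp lp sp]] := reach_dist u v.
apply/dist_le/reach_inP; exists (rcons p w).
by rewrite rcons_path pp lp vw last_rcons size_rcons sp.
Qed.

(** Dropping the last vertex of a shortest walk leaves a shortest walk, so one step back lowers the
    distance by exactly one; the induction is on the gap down to [j]. *)
Lemma dist_intermediate u v j :
  j <= dist e u v -> exists w, dist e u w = j.
Proof.
have [m] := ubnP (dist e u v - j); elim: m v => // m IH v hm jd.
have [->|/eqP nj] := eqVneq j (dist e u v); first by exists v.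
have {nj}jd : j < dist e u v by rewrite ltn_neqAle jd andbT; apply/eqP.
have /reach_inP[p [pp lp sp]] := reach_dist u v.
case/lastP: p => [|q x] in pp lp sp; first by rewrite -sp in jd.
move: pp lp sp; rewrite rcons_path last_rcons size_rcons => /andP[pq ex] xv sq; subst x.
have le1 : dist e u (last u q) <= size q by apply/dist_le/reach_inP; exists q.
have ge1 := dist_step u ex; rewrite -sq ltnS in ge1.
have E : dist e u (last u q) = size q by apply/eqP; rewrite eqn_leq le1.
move: hm jd; rewrite -sq => hm jd.
apply: (IH (last u q)); rewrite E //.
by rewrite subSn // ltnS in hm.
Qed.

(** Cutting the loops out of [p] leaves a duplicate-free walk on some of its vertices; by minimality
    it is no shorter, so nothing was cut. *)
Lemma shortest_uniq k l p :
  path e k p -> last k p = l -> size p = dist e k l -> uniq (k :: p).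
Proof.
move=> pp lp sp; move: (pp) (lp).
case: (shortenP pp) => q pq uq sub _ lq.
have szq : size p <= size q by rewrite sp; apply/dist_le/reach_inP; exists q.
move: uq => /= /andP[kq uq].
have [_ eqm] := uniq_min_size uq sub szq.
by rewrite -eqm kq (leq_size_uniq uq sub szq).
Qed.

Lemma nsp_gt0 k l : 0 < nsp e k l.
Proof.
have /existsP[p hp] := reach_dist k l.
by apply/card_gt0P; exists p; rewrite inE.
Qed.

Lemma mem_zip_path u v k p :
  (u, v) \in zip (k :: p) p -> (u \in k :: p) && (v \in p).
Proof.
elim: p k => //= a p IH k; rewrite inE xpair_eqE.
case/orP=> [/andP[/eqP-> /eqP->]|/IH/andP[up vp]]; first by rewrite !mem_head.
by rewrite inE up orbT inE vp orbT.
Qed.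

(** On a duplicate-free walk, [u] has a predecessor exactly when it lies in [p] and a successor
    exactly when it lies in [belast k p], and these two are distinct. *)
Lemma card_uses_edge k p u : uniq (k :: p) ->
  #|[set v | uses_edge k p u v]| = (u \in p) + (u \in belast k p).
Proof.
elim: p k => [|a p IH] k /=.
  by move=> _; apply/eqP; rewrite cards_eq0; apply/eqP/setP => v; rewrite !inE.
move=> /andP[]; rewrite inE negb_or => /andP[ka kp] uap.
have kb : k \notin belast a p.
  apply/negP => /mem_belast; rewrite inE (negbTE kp) orbF; exact/negP.
have zl x y := @mem_zip_path x y a p.
have {}IH := IH a uap.
have uE x v : uses_edge k (a :: p) x v =
   (x == k) && (v == a) || (x == a) && (v == k) || uses_edge a p x v.
  rewrite /uses_edge /= !inE !xpair_eqE.
  by rewrite (andbC (v == k)) -!orbA; do !bool_congr.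
have nk v : uses_edge a p k v = false.
  by apply/negP => /orP[] /zl; rewrite ?inE ?(negbTE ka) (negbTE kp) ?andbF.
have nk' v : uses_edge a p v k = false.
  by rewrite /uses_edge orbC; exact: nk.
have [->|uk] := eqVneq u k.
  rewrite !inE eqxx (negbTE ka) (negbTE kp) /= (_ : [set v | _] = [set a]) ?cards1 //.
  by apply/setP => v; rewrite !inE uE nk eqxx (negbTE ka) /= !orbF.
rewrite !inE (negbTE uk) /=.
have [ua|ua] := eqVneq u a.
  have ap : u \notin p by rewrite ua; case/andP: uap.
  (* The second vertex gains the predecessor [k], which is new because [k] does not occur later; the
     induction hypothesis counts only its successor. *)
  rewrite (_ : [set v | _] = k |: [set v | uses_edge a p u v]); last first.
    apply/setP => v; rewrite !inE uE ua.
    by rewrite (eq_sym a k) (negbTE ka) eqxx.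
  by rewrite cardsU1 inE nk' /= IH (negbTE ap).
rewrite /= -IH; apply: eq_card => v; rewrite !inE uE (negbTE uk) (negbTE ua) //.
Qed.

Hypothesis esym : symmetric e.

Lemma uses_edge_adj k p u v : path e k p -> uses_edge k p u v -> e u v.
Proof.
have H x y : path e k p -> (x, y) \in zip (k :: p) p -> e x y.
  elim: p k => [|a p IH] k //= /andP[ka pp].
  by rewrite inE xpair_eqE => /orP[/andP[/eqP-> /eqP->]|/(IH _ pp)].
by move=> pp /orP[] /(H _ _ pp) //; rewrite esym.
Qed.

Lemma rev_path_sym k p : path e k p -> path e (last k p) (rev (belast k p)).
Proof. by rewrite rev_path; apply: sub_path => x y; rewrite /= esym. Qed.

(** The reverse of the walk [k :: p] starts at [last k p] and continues with [rev (belast k p)];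
    together with [last_rev_belast] this makes reversal an involution. *)
Lemma rev_belastK k p : rev (belast (last k p) (rev (belast k p))) = p.
Proof.
have : last k p :: rev (belast k p) = rev (k :: p) by rewrite (lastI k) rev_rcons.
move: (rev (belast k p)) => q /(congr1 rev).
by rewrite revK (lastI _ q) rev_rcons => -[].
Qed.

Lemma last_rev_belast k p : last (last k p) (rev (belast k p)) = k.
Proof.
have : last k p :: rev (belast k p) = rev (k :: p) by rewrite (lastI k) rev_rcons.
move: (rev (belast k p)) => q /(congr1 rev).
by rewrite revK (lastI _ q) rev_rcons => -[].
Qed.

Lemma reach_in_sym n u v : reach_in e n u v = reach_in e n v u.
Proof.
suff H a b : reach_in e n a b -> reach_in e n b a by apply/idP/idP; exact: H.
case/reach_inP=> p [pp lp sp]; apply/reach_inP; exists (rev (belast a p)).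
by rewrite -lp rev_path_sym // last_rev_belast size_rev size_belast.
Qed.

Lemma dist_sym u v : dist e u v = dist e v u.
Proof. by apply: eq_find => n; rewrite reach_in_sym. Qed.

End Distance.

(** At [n = dist e k l] this is [spaths]; freeing the length from the end-points lets it be
    rewritten when they are swapped or moved by an automorphism. *)
Definition walks (T : finType) (e : rel T) n (k l : T) : {set n.-tuple T} :=
  [set p : n.-tuple T | path e k p && (last k p == l)].

(* The number of steps of the path [k :: p] having [u] as an end-point. *)
Definition degree_in (T : finType) (k : T) (p : seq T) (u : T) : nat :=
  ((u \in p) + (u \in belast k p))%N.

(** * Walks of fixed length, their symmetries, and the steps incident to a vertex *)

Section Walks.
Local Open Scope nat_scope.
Variables (T : finType) (e : rel T).
Implicit Types (k l u v w : T) (p : seq T) (n : nat).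

Lemma mem_walks n k l (p : n.-tuple T) :
  (p \in walks e n k l) = path e k p && (last k p == l).
Proof. by rewrite inE. Qed.

Lemma reach_in_walks n k l : reach_in e n k l = (0 < #|walks e n k l|).
Proof.
apply/existsP/card_gt0P => -[p hp]; exists p; by rewrite ?inE // in hp *.
Qed.

Lemma sum_walks_rev (R : nmodType) n k l (F G : seq T -> R) : symmetric e ->
  (forall p, last k p = l -> F p = G (rev (belast k p))) ->
  (\sum_(p in walks e n k l) F p = \sum_(p in walks e n l k) G p)%R.
Proof.
move=> esym FG.
rewrite (reindex_onto (fun q : n.-tuple T => [tuple of rev (belast l q)])
  (fun p : n.-tuple T => [tuple of rev (belast k p)])) /=; last first.
  move=> p; rewrite mem_walks => /andP[_ /eqP <-].
  by apply: val_inj; rewrite /= rev_belastK.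
apply: congr_big => // [q|q]; last first.
  move=> /andP[]; rewrite mem_walks /= => /andP[_ /eqP lq] /eqP/(congr1 val) /= E.
  by rewrite FG // E.
rewrite !mem_walks -val_eqE /=; apply/idP/idP.
  move=> /andP[/andP[]]; move: (rev (belast l q)) => r pr /eqP <- /eqP <-.
  by rewrite rev_path_sym // last_rev_belast eqxx.
move=> /andP[pq /eqP <-].
by rewrite rev_path_sym // last_rev_belast rev_belastK !eqxx.
Qed.

Lemma sum_walks_perm (R : nmodType) (f : {perm T}) n k l (F : seq T -> R) :
  (forall x y, e (f x) (f y) = e x y) ->
  (\sum_(p in walks e n (f k) (f l)) F p
    = \sum_(p in walks e n k l) F (map f p))%R.
Proof.
move=> fe.
rewrite (reindex (fun q : n.-tuple T => [tuple of map f q])) /=; last first.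
  exists (fun q : n.-tuple T => [tuple of map (f^-1)%g q]) => q _;
    by apply: val_inj; rewrite /= -map_comp ?(eq_map (permK f)) ?(eq_map (permKV f)) map_id.
apply: eq_bigl => q; rewrite !mem_walks /= last_map (inj_eq perm_inj); congr (_ && _).
by elim: (val q) k => //= a s IH k; rewrite fe IH.
Qed.

Lemma card_walks_rev n k l : symmetric e -> #|walks e n k l| = #|walks e n l k|.
Proof.
move=> esym; rewrite -!sum1_card.
exact: (@sum_walks_rev nat n k l (fun=> 1) (fun=> 1)).
Qed.

Lemma card_walks_perm (f : {perm T}) n k l :
  (forall x y, e (f x) (f y) = e x y) -> #|walks e n (f k) (f l)| = #|walks e n k l|.
Proof. by move=> fe; rewrite -!sum1_card; exact: (@sum_walks_perm nat f n k l (fun=> 1)). Qed.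

Lemma dist_perm (f : {perm T}) k l :
  (forall x y, e (f x) (f y) = e x y) -> dist e (f k) (f l) = dist e k l.
Proof.
by move=> fe; apply: eq_find => n; rewrite !reach_in_walks card_walks_perm.
Qed.

Lemma degree_in_rev k p u : degree_in (last k p) (rev (belast k p)) u = degree_in k p u.
Proof.
by rewrite /degree_in mem_rev addnC -[u \in belast (last _ _) _]mem_rev rev_belastK.
Qed.

Lemma degree_in_perm (f : {perm T}) k p u :
  degree_in (f k) (map f p) (f u) = degree_in k p u.
Proof. by rewrite /degree_in belast_map !mem_map //; exact: perm_inj. Qed.

Lemma sum_degree_in k p : uniq (k :: p) ->
  \sum_u degree_in k p u = (size p).*2.
Proof.
move=> /= /andP[kp up]; rewrite /degree_in big_split /=.
have card_mem (s : seq T) : uniq s -> \sum_u (u \in s : nat) = size s.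
  by move=> /card_uniqP <-; rewrite -sum1_card [RHS]big_mkcond /=;
    apply: eq_bigr => u _; case: (u \in s).
rewrite !card_mem // ?size_belast ?addnn //.
have : uniq (k :: p) by rewrite /= kp.
by rewrite lastI rcons_uniq => /andP[].
Qed.

Lemma degree_in_ends k p u : p != [::] ->
  (k == u) + (last k p == u) <= degree_in k p u.
Proof.
case: p => //= a p _; rewrite addnC /degree_in leq_add //.
  by case: eqP => // <-; rewrite mem_last.
by case: eqP => // <-; rewrite mem_head.
Qed.

(** A vertex with a single possible neighbour meets at most one step of a duplicate-free walk, so it
    cannot be interior. *)
Lemma degree_in_leaf k p u w : (forall x, e u x -> x = w) -> symmetric e ->
  path e k p -> uniq (k :: p) -> p != [::] ->
  degree_in k p u = (k == u) + (last k p == u).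
Proof.
move=> leaf esym pp up pn.
apply/eqP; rewrite eqn_leq degree_in_ends // andbT.
have sub1 : degree_in k p u <= 1.
  rewrite /degree_in -card_uses_edge //.
  apply: leq_trans (_ : #|[set w]| <= 1); last by rewrite cards1.
  apply/subset_leq_card/subsetP => v; rewrite !inE => h.
  by rewrite (leaf v) // (uses_edge_adj esym pp h).
have [_|nk] := eqVneq k u; first by rewrite (leq_trans sub1).
have [_|nl] := eqVneq (last k p) u; first by rewrite (leq_trans sub1).
(* An interior vertex of [k :: p] is the end-point of two of its steps. *)
have E : (u \in belast k p) = (u \in p).
  have : (u \in k :: p) = (u \in rcons (belast k p) (last k p)) by rewrite -lastI.
  by rewrite mem_rcons !inE ![u == _]eq_sym (negbTE nk) (negbTE nl).
by move: sub1; rewrite /degree_in E; case: (u \in p).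
Qed.

End Walks.

(** * Edge betweenness at a vertex as a sum over pairs of end-points *)

Section Flow.
Variables (R : realFieldType) (lam : R) (T : finType) (e : rel T).
Hypotheses (lam_gt0 : 0 < lam) (esym : symmetric e) (conn : connected_graph e).
Implicit Types (k l u v w : T).

(** The contribution of the pair [k], [l] to [cexp] at [u]: the average of [degree_in] over the
    shortest paths, weighted by [lam ^+ dist e k l]. *)
Definition flow u k l : R :=
  (\sum_(p in walks e (dist e k l) k l) (degree_in k p u)%:R)
    / (nsp e k l)%:R * lam ^+ dist e k l.

Lemma walks_shortest k l (p : (dist e k l).-tuple T) :
  p \in walks e (dist e k l) k l ->
  [/\ path e k p, uniq (k :: p) & last k p = l].
Proof.
rewrite mem_walks => /andP[pp /eqP lp]; split=> //.
exact: (shortest_uniq pp lp (size_tuple p)).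
Qed.

Lemma nsp_neq0 k l : (nsp e k l)%:R != 0 :> R.
Proof. by rewrite pnatr_eq0 -lt0n nsp_gt0. Qed.

Lemma flow_const u k l c :
  (forall p : (dist e k l).-tuple T, p \in walks e (dist e k l) k l ->
     degree_in k p u = c) ->
  flow u k l = c%:R * lam ^+ dist e k l.
Proof.
move=> pc; rewrite /flow (eq_bigr (fun=> c%:R)) => [|p /pc -> //].
by rewrite sumr_const -[c%:R *+ _]mulr_natr mulfK // nsp_neq0.
Qed.

Lemma flow_sym u k l : flow u k l = flow u l k.
Proof.
(* Both counts are unfolded to cardinals of [walks], so that the length can be rewritten by symmetry
   of the distance. *)
rewrite /flow -[nsp e k l]/#|walks e (dist e k l) k l|.
rewrite -[nsp e l k]/#|walks e (dist e l k) l k|.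
rewrite (dist_sym esym l k) (card_walks_rev _ l k esym); congr (_ / _ * _).
apply: sum_walks_rev (fun p => (degree_in k p u)%:R)
  (fun p => (degree_in l p u)%:R) esym _.
by move=> p <-; rewrite degree_in_rev.
Qed.

Lemma flow_perm (f : {perm T}) u k l :
  (forall x y, e (f x) (f y) = e x y) -> flow (f u) (f k) (f l) = flow u k l.
Proof.
move=> fe.
rewrite /flow -[nsp e k l]/#|walks e (dist e k l) k l|.
rewrite -[nsp e (f k) (f l)]/#|walks e (dist e (f k) (f l)) (f k) (f l)|.
rewrite (dist_perm k l fe) card_walks_perm //; congr (_ / _ * _).
rewrite (sum_walks_perm _ _ _ (fun p => (degree_in (f k) p (f u))%:R) fe).
by apply: eq_bigr => p _; rewrite degree_in_perm.
Qed.

Lemma cexp_flow u : cexp e lam u =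
  \sum_k \sum_(l | (enum_rank k < enum_rank l)%N) flow u k l.
Proof.
rewrite /cexp /bexp exchange_big /=; apply: eq_bigr => k _.
rewrite exchange_big /=; apply: eq_bigr => l _.
rewrite -mulr_suml; congr (_ * _); rewrite -mulr_suml; congr (_ / _).
rewrite -natr_sum -natr_sum; congr (_%:R).
rewrite (eq_bigr (fun v =>
  \sum_(p in walks e (dist e k l) k l) (uses_edge k p u v : nat))%N); last first.
  move=> v _; rewrite /nsp_edge -sum1_card big_mkcond [RHS]big_mkcond /=.
  apply: eq_bigr => p _; rewrite inE -/(walks e (dist e k l) k l).
  by case: (p \in _) => //; case: uses_edge.
(* For one fixed path, the [v] with [uv] on the path number [degree_in k p u]; restricting to
   neighbours of [u] loses nothing, as every step is an edge. *)
rewrite exchange_big /=; apply: eq_bigr => p /walks_shortest[pp up _].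
rewrite /degree_in -card_uses_edge // -sum1_card big_mkcond [RHS]big_mkcond /=.
apply: eq_bigr => v _; rewrite inE.
case: ifP => [_|]; first by case: uses_edge.
by case: ifP => // /(uses_edge_adj esym pp) ->.
Qed.

(** Since [flow] is symmetric in its end-points, doubling replaces the enumeration by [enum_rank]
    with a sum over all ordered pairs. *)
Lemma cexp_flow2 u : cexp e lam u *+ 2 = \sum_k \sum_(l | l != k) flow u k l.
Proof.
rewrite cexp_flow mulr2n.
rewrite {2}(eq_bigr _ (fun k _ => big_mkcond _ _)) exchange_big -big_split /=.
apply: eq_bigr => k _; rewrite -big_mkcond [X in X + _]big_mkcond.
rewrite [X in _ + X]big_mkcond [RHS]big_mkcond -big_split; apply: eq_bigr => l _ /=.
rewrite (flow_sym u l k) -(inj_eq enum_rank_inj) -(inj_eq val_inj) /=.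
by case: ltngtP => _; rewrite ?addr0 ?add0r.
Qed.

Lemma path_neq0 k l (p : (dist e k l).-tuple T) : l != k -> val p != [::].
Proof.
by move=> lk; rewrite -size_eq0 size_tuple dist_eq0 // eq_sym.
Qed.

(** Every shortest path has [dist e k l] steps with two ends each. *)
Lemma sum_flow k l : \sum_u flow u k l = (dist e k l)%:R * lam ^+ dist e k l *+ 2.
Proof.
rewrite /flow -!mulr_suml exchange_big /=.
rewrite (eq_bigr (fun=> (dist e k l).*2%:R)) => [|p /walks_shortest[_ up _]]; last first.
  by rewrite -natr_sum sum_degree_in // size_tuple.
rewrite sumr_const -[X in X / _]mulr_natr mulfK ?nsp_neq0 //.
by rewrite -muln2 natrM mulrAC mulr_natr.
Qed.

Lemma sum_nuexp : \sum_u nuexp e lam u = 0.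
Proof.
(* Summed over [u], both doubled quantities give each ordered pair of distinct vertices twice its
   distance times its weight. *)
have/eqP: \sum_u cexp e lam u *+ 2 = \sum_u texp e lam u *+ 2.
  rewrite (eq_bigr _ (fun u _ => cexp_flow2 u)) exchange_big /=.
  apply: eq_bigr => k _; rewrite exchange_big /texp -sumrMnl /=.
  by apply: eq_bigr => l _; rewrite sum_flow.
rewrite !sumrMnl eqr_pMn2r // => /eqP E.
by rewrite /nuexp sumrB E subrr.
Qed.

Lemma nuexp_perm (f : {perm T}) u :
  (forall x y, e (f x) (f y) = e x y) -> nuexp e lam (f u) = nuexp e lam u.
Proof.
move=> fe; rewrite /nuexp; congr (_ - _).
  (* Doubling passes to ordered pairs, which an automorphism permutes; it need not preserve the
     order of [enum_rank]. *)
  apply/eqP; rewrite -(eqr_pMn2r (n := 2)) // !cexp_flow2; apply/eqP.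
  rewrite (reindex_inj (@perm_inj _ f)) /=; apply: eq_bigr => k _.
  rewrite (reindex_inj (@perm_inj _ f)) /=; apply: eq_big => l.
    by rewrite (inj_eq perm_inj).
  by rewrite flow_perm.
rewrite /texp (reindex_inj (@perm_inj _ f)) /=; apply: eq_big => l.
  by rewrite (inj_eq perm_inj).
by rewrite dist_perm.
Qed.

Lemma flow_ends u k l : l != k ->
  ((k == u) + (l == u))%:R * lam ^+ dist e k l <= flow u k l.
Proof.
move=> lk; apply: ler_wpM2r; first by rewrite exprn_ge0 1?ltW.
rewrite ler_pdivlMr ?ltr0n ?nsp_gt0 // mulr_natr.
rewrite -[nsp e k l]/#|walks e (dist e k l) k l| -sumr_const.
apply: ler_sum => p /walks_shortest[_ _ lp].
have := degree_in_ends k u (path_neq0 p lk); rewrite lp => le_deg.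
by rewrite ler_nat.
Qed.

(** Among ordered pairs, [u] occurs once as first and once as second entry with each other
    vertex. *)
Lemma sum_ends u :
  \sum_k \sum_(l | l != k) ((k == u) + (l == u))%:R * lam ^+ dist e k l
    = (\sum_(v | v != u) lam ^+ dist e u v) *+ 2.
Proof.
have split2 k l : ((k == u) + (l == u))%:R * lam ^+ dist e k l =
   (if k == u then lam ^+ dist e k l else 0) + (if l == u then lam ^+ dist e k l else 0).
  by rewrite natrD mulrDl; do 2! case: eqP => _; rewrite ?mul1r ?mul0r.
under eq_bigr => k _ do under eq_bigr => l _ do rewrite split2.
under eq_bigr do rewrite big_split /=.
rewrite big_split mulr2n /=; congr (_ + _).
  rewrite (bigD1 u) //= eqxx [X in _ + X]big1 ?addr0 // => k /negbTE ku.
  by rewrite big1 // => l _; rewrite ku.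
rewrite [RHS]big_mkcond; apply: eq_bigr => k _.
rewrite -big_mkcondr /=; case: ifP => [ku|/eqP->].
  rewrite (big_pred1 u) => [|l]; first by rewrite dist_sym.
  by rewrite /= andbC; case: eqP => // ->; rewrite eq_sym.
by rewrite big1 // => l /andP[/negbTE->].
Qed.

Lemma nuexp_ge u :
  \sum_(v | v != u) (1 - (dist e u v)%:R) * lam ^+ dist e u v <= nuexp e lam u.
Proof.
under eq_bigr do rewrite mulrBl mul1r.
rewrite sumrB lerD2r -(ler_pMn2r (n := 2)) // -sum_ends cexp_flow2.
by apply: ler_sum => k _; apply: ler_sum => l; exact: flow_ends.
Qed.

Lemma nuexp_leaf u w : (forall x, e u x -> x = w) ->
  nuexp e lam u = \sum_(v | v != u) (1 - (dist e u v)%:R) * lam ^+ dist e u v.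
Proof.
move=> leaf; under eq_bigr do rewrite mulrBl mul1r.
rewrite sumrB; congr (_ - _); apply/eqP.
rewrite -(eqr_pMn2r (n := 2)) // -sum_ends cexp_flow2; apply/eqP.
apply: eq_bigr => k _; apply: eq_bigr => l lk.
apply: flow_const => p /walks_shortest[pp up lp].
by rewrite (degree_in_leaf leaf esym pp up) ?path_neq0 // lp.
Qed.

End Flow.

(** * The minimum surplus, its sign, and vertex-transitive graphs *)

Section Minimum.
Variables (R : realFieldType) (lam : R) (T : finType) (e : rel T).

Lemma mnuexp_le u : mnuexp e lam <= nuexp e lam u.
Proof.
rewrite /mnuexp; case: pickP => [v _|/(_ u)//]; exact: bigmin_le.
Qed.

Lemma mnuexp_ge c : (0 < #|T|)%N -> (forall u, c <= nuexp e lam u) ->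
  c <= mnuexp e lam.
Proof.
move=> T0 h; rewrite /mnuexp; case: pickP => [v _|/eq_card0 E].
  by apply: le_bigmin => // i _.
by rewrite E in T0.
Qed.

(** The minimum is at most the average of the surpluses, which is 0. *)
Lemma mnuexp_le0 : symmetric e -> connected_graph e -> (0 < #|T|)%N ->
  mnuexp e lam <= 0.
Proof.
move=> esym conn T0; rewrite -(ler_pMn2r T0) mul0rn -(sum_nuexp lam esym conn).
by rewrite -sumr_const; apply: ler_sum => u _; exact: mnuexp_le.
Qed.

Lemma mnuexp_transitive : symmetric e -> connected_graph e -> (0 < #|T|)%N ->
  vertex_transitive e -> mnuexp e lam = 0.
Proof.
move=> esym conn T0 vt; apply/le_anti; rewrite mnuexp_le0 //=.
(* Transitivity makes all surpluses equal, so [#|T|] times any one of them is their sum 0. *)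
apply: mnuexp_ge => // u; rewrite -(pmulrn_lge0 _ T0) -(sum_nuexp lam esym conn).
rewrite le_eqVlt; apply/orP; left; rewrite -sumr_const; apply/eqP/eq_bigr => v _.
by have [f [<- fe]] := vt u v; rewrite nuexp_perm.
Qed.

End Minimum.

(** * The lower bound as a sum over distances, and its minimization *)

Section LowerBound.
Variables (R : realFieldType) (lam : R).
Hypotheses (lam_gt0 : 0 < lam) (lam_lt1 : lam < 1).

Definition dterm (k : nat) : R := (1 - k%:R) * lam ^+ k.

Lemma lbtermE n D :
  lbterm n lam D = \sum_(1 <= k < D.+1) dterm k + (n - D - 1)%:R * dterm D.
Proof.
rewrite /lbterm /dterm; congr (_ + _ * _); last by ring.
have l1 : lam - 1 != 0 by rewrite subr_eq0 lt_eqF.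
(* With the denominator cleared, induction can start at [D = 0], where the closed form also
   vanishes. *)
apply: (mulIf (expf_neq0 2 l1)); rewrite mulfVK ?expf_neq0 //.
elim: D => [|D IH]; first by rewrite big_geq //; ring.
rewrite big_nat_recr //= [RHS]mulrDl -IH -natr1 !exprS; ring.
Qed.

Lemma lbound_le n D : (1 <= D < n)%N -> lbound n lam <= lbterm n lam D.
Proof. by move=> h; apply: ge_bigmin_seq; rewrite ?mem_index_iota. Qed.

(** The side condition excludes [D = 1] for [n > 2]: that broom is a star whose starting vertex is
    the centre, not a leaf. *)
Lemma lbound_attained n : (2 <= n)%N ->
  exists2 D, (1 <= D < n)%N & lbound n lam = lbterm n lam D /\ (D = 1 -> n = 2)%N.
Proof.
move=> n2.
have [n3|n3] := leqP n 2.
  have -> : n = 2 by lia.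
  exists 1%N => //; split=> //.
  by rewrite /lbound big_nat1_id minxx.
(* The term at 1 is 0 because [dterm 1 = 0], while the term at 2 is negative. *)
have lt21 : lbterm n lam 2 < lbterm n lam 1.
  rewrite !lbtermE !big_nat1 big_nat_recr // big_nat1 /= /dterm.
  have l2 : 0 < lam ^+ 2 by rewrite exprn_gt0.
  have := ler0n R (n - 2 - 1); set a := _%:R => a0; nra.
have hD : exists2 D, (1 <= D < n)%N & lbound n lam = lbterm n lam D.
  rewrite /lbound big_seq.
  apply: (big_ind (fun x => exists2 D, (1 <= D < n)%N & x = lbterm n lam D)) =>
    [|x y [D1 h1 ->] [D2 h2 ->]|D].
  - by exists 1%N => //; lia.
  - by case: leP => _; [exists D1|exists D2].
  - by rewrite mem_index_iota => h; exists D.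
case: hD => D hD E; exists D => //; split=> // D1.
by have := @lbound_le n 2; rewrite E D1 => /(_ n3); rewrite leNgt lt21.
Qed.

Variables (T : finType) (e : rel T).
Hypotheses (esym : symmetric e) (conn : connected_graph e).

Lemma lbound_le_sum u : (2 <= #|T|)%N ->
  lbound #|T| lam <= \sum_(v | v != u) dterm (dist e u v).
Proof.
move=> T2.
have [v0 v0u] : exists v0, v0 != u.
  apply/existsP; rewrite -[[exists _, _]]negbK negb_exists; apply/negP => /forallP h.
  move: T2; rewrite (@eq_card1 _ u) // => v; rewrite !inE.
  by have := h v; rewrite negbK.
case: (@arg_minP _ _ T v0 (fun v => v != u) (fun v => dterm (dist e u v)) v0u) => v vu vmin.
set D := dist e u v.
have D0 : (0 < D)%N by rewrite lt0n dist_eq0 // eq_sym.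
have DT : (D < #|T|)%N by exact: dist_lt_card.
apply: le_trans (_ : lbterm #|T| lam D <= _); first by apply: lbound_le; rewrite D0.
(* Measured from its minimum, the summand is nonnegative at every distance that occurs. Both sides
   then contain [#|T| - 1] copies of [dterm D], which cancel. *)
pose h k := dterm k - dterm D.
have h0 w : w != u -> 0 <= h (dist e u w) by move=> wu; rewrite subr_ge0 vmin.
have sumD (P : pred T) : \sum_(w | P w) dterm (dist e u w)
   = \sum_(w | P w) h (dist e u w) + #|P|%:R * dterm D.
  rewrite mulr_natl -sumr_const -big_split /=; apply: eq_bigr => w _.
  by rewrite /h subrK.
rewrite sumD lbtermE.
have -> : \sum_(1 <= k < D.+1) dterm k = \sum_(1 <= k < D.+1) h k + D%:R * dterm D.
  rewrite /h sumrB sumr_const_nat subn1 /= mulr_natl subrK //.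
rewrite -addrA -mulrDl -natrD.
have -> : #|(fun w => w != u)| = (D + (#|T| - D - 1))%N.
  by rewrite (cardC1 u); lia.
rewrite lerD2r.
have hk k : (1 <= k < D.+1)%N -> exists2 w, w != u & dist e u w = k.
  move=> /andP[k1]; rewrite ltnS => kD.
  have [w wk] := dist_intermediate conn kD; exists w => //.
  by rewrite -wk lt0n dist_eq0 // eq_sym in k1.
(* Vertices are grouped by their distance [k]; those farther than [D] are discarded, and each [k]
   from 1 to [D] keeps at least one vertex. *)
apply: le_trans
  (_ : \sum_(w | w != u) \sum_(1 <= k < D.+1 | k == dist e u w) h k <= _); last first.
  apply: ler_sum => w wu.
  have [wD|wD] := leqP (dist e u w) D.
    rewrite -big_filter (_ : [seq _ <- _ | _] = [:: dist e u w]) ?big_seq1 //.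
    rewrite filter_pred1_uniq ?iota_uniq // mem_index_iota ltnS wD andbT.
    by rewrite lt0n dist_eq0 // eq_sym.
  rewrite big_nat_cond big_pred0 ?h0 // => k; apply/negP => /andP[/andP[_ kD] /eqP kw]; lia.
under [leRHS]eq_bigr do rewrite big_mkcond.
rewrite exchange_big /= big_nat_cond [leRHS]big_nat_cond.
apply: ler_sum => k; rewrite andbT => /hk[w wu <-].
rewrite -big_mkcondr (bigD1 w) ?wu ?eqxx //= lerDl.
by apply: sumr_ge0 => x /andP[/andP[xu /eqP->] _]; exact: h0.
Qed.

End LowerBound.

(** * Distances in the broom and the surplus of its starting vertex *)

Section Broom.
Local Open Scope nat_scope.
Variables n D : nat.
Hypothesis hD : 1 <= D < n.
Let e := broom n D.
Implicit Types u v w x : 'I_n.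

Lemma broom_sym : symmetric e.
Proof. by move=> [u hu] [v hv]; rewrite /e /broom /=; lia. Qed.

(* For [D = 1] the starting vertex is the centre of a star. *)
Lemma broom_leaf u x : (D = 1 -> n = 2) -> val u = 0 -> e u x -> val x = 1.
Proof.
by rewrite /e /broom /= => D1 u0; have := ltn_ord x; lia.
Qed.

(** Up to [D] the handle is followed; a vertex beyond [D] is one step from [D.-1], hence also [D]
    steps from the start. *)
Lemma reach_in_broom u x : val u = 0 -> reach_in e (minn x D) u x.
Proof.
move=> u0.
have path_reach j : j <= D -> forall w, val w = j -> reach_in e j u w.
  elim: j => [|j IH] jD w wj.
    by apply/reach_inP; exists [::]; split=> //; apply: val_inj; rewrite /= u0 wj.
  have jn : j < n by lia.
  have /reach_inP[p [pp lp sp]] := IH (ltnW jD) (Ordinal jn) erefl.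
  apply/reach_inP; exists (rcons p w); rewrite rcons_path pp lp last_rcons size_rcons sp.
  by split=> //; rewrite /e /broom /=; move: wj => /=; lia.
have [xD|Dx] := leqP x D; first by exact: path_reach.
have Dn : D.-1 < n by lia.
have /reach_inP[p [pp lp sp]] := path_reach D.-1 (leq_pred D) (Ordinal Dn) erefl.
apply/reach_inP; exists (rcons p x); rewrite rcons_path pp lp last_rcons size_rcons sp.
by split=> //; [rewrite /e /broom /=|]; lia.
Qed.

Lemma broom_connected : connected_graph e.
Proof.
have n0 : 0 < n by lia.
have from0 x : connect e (Ordinal n0) x.
  have /reach_inP[p [pp <- _]] := @reach_in_broom (Ordinal n0) x erefl.
  by apply/connectP; exists p.
move=> u v; apply: connect_trans (from0 v).
by rewrite (sym_connect_sym broom_sym).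
Qed.

Lemma broom_dist u x : val u = 0 -> dist e u x = minn x D.
Proof.
move=> u0; apply/eqP; rewrite eqn_leq dist_le ?reach_in_broom //=.
(* The potential [minn v D] grows by at most one along an edge, so no walk from the start is
   shorter. *)
have pot p v : path e v p -> minn (last v p) D <= minn v D + size p.
  elim: p v => [|a p IH] v /=; first by rewrite addn0.
  move=> /andP[va /IH]; suff : minn a D <= (minn v D).+1 by lia.
  by move: va; rewrite /e /broom /=; lia.
have /reach_inP[p [pp lp <-]] := reach_dist broom_connected u x.
by have := pot p u pp; rewrite lp; move: u0 => /= ->; lia.
Qed.

End Broom.

Lemma nuexp_broom (R : realFieldType) (lam : R) n D (u : 'I_n) :
  lam < 1 -> (1 <= D < n)%N -> (D = 1 -> n = 2)%N -> val u = 0%N ->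
  nuexp (broom n D) lam u = lbterm n lam D.
Proof.
move=> lam1 hD D1 u0.
have n1 : (1 < n)%N by lia.
have leaf x : broom n D u x -> x = Ordinal n1.
  by move=> ux; apply: val_inj; rewrite /= (broom_leaf hD D1 u0 ux).
rewrite (nuexp_leaf lam (broom_sym hD) (broom_connected hD) leaf) lbtermE //.
under eq_bigr do rewrite (broom_dist hD _ u0) -/(dterm lam _).
rewrite (eq_bigl (fun v : 'I_n => (1 <= v)%N)) => [|v]; last first.
  by rewrite -(inj_eq val_inj) u0 lt0n.
rewrite -(big_geq_mkord _ _ xpredT (fun i => dterm lam (minn i D))) /=.
(* Vertices 1 to [D] realize each distance once; the other [n - D - 1] all lie at distance [D]. *)
rewrite (@big_cat_nat _ _ _ D.+1) /=; [|lia|lia].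
congr (_ + _).
  by apply: eq_big_nat => k hk; congr dterm; lia.
rewrite (eq_big_nat _ _ (F2 := fun=> dterm lam D)) => [|k hk]; last first.
  by congr dterm; lia.
by rewrite sumr_const_nat mulr_natl; congr (_ *+ _); lia.
Qed.

(** * Assembly of the bounds and of the cases of equality *)

Theorem theorem11 (R : realFieldType) (lam : R) (hlam0 : 0 < lam) (hlam1 : lam < 1) :
  (forall (T : finType) (e : rel T),
      symmetric e -> irreflexive e -> connected_graph e -> (2 <= #|T|)%N ->
      lbound #|T| lam <= mnuexp e lam <= 0)
  /\ (forall n : nat, (2 <= n)%N ->
      exists D : nat, [/\ (1 <= D <= n - 1)%N,
        mnuexp (broom n D) lam = lbound n lam &
        forall u : 'I_n, val u = 0%N -> nuexp (broom n D) lam u = lbound n lam])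
  /\ (forall (T : finType) (e : rel T),
      symmetric e -> irreflexive e -> connected_graph e -> (2 <= #|T|)%N ->
      vertex_transitive e -> mnuexp e lam = 0).
Proof.
have lower (T : finType) (e : rel T) : symmetric e -> connected_graph e ->
    (2 <= #|T|)%N -> lbound #|T| lam <= mnuexp e lam.
  move=> esym conn T2; apply: mnuexp_ge => [|u]; first exact: ltnW.
  exact: le_trans (lbound_le_sum hlam0 hlam1 conn u T2) (nuexp_ge hlam0 esym conn u).
split; [|split].
- move=> T e esym _ conn T2.
  by rewrite lower //= mnuexp_le0 // ltnW.
- move=> n n2; have [D hD [eqD D1]] := lbound_attained hlam0 hlam1 n2.
  have nu0 u : val u = 0%N -> nuexp (broom n D) lam u = lbterm n lam D.
    exact: nuexp_broom.
  rewrite eqD; exists D; split=> //; first by lia.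
  (* The general lower bound applies to the broom itself, and its starting vertex already has this
     value, so the minimum equals it. *)
  have := lower _ _ (broom_sym hD) (broom_connected hD); rewrite card_ord eqD => /(_ n2) ge_lb.
  by apply/le_anti; rewrite ge_lb -(nu0 (Ordinal (ltnW n2))) // mnuexp_le.
- move=> T e esym _ conn T2 vt.
  by apply: mnuexp_transitive => //; exact: ltnW.
Qed.
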